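(* Let $a=\{a_j\}_{j\ge1}$ be a positive, decreasing, summable sequence and $C_a$ the associated Cantor set. Put $s_n=2^{-n}\sum_{j=2^n}^\infty a_j$ for $n\ge0$. Then $$\dim_A C_a=\inf\Bigl\{\beta:\ \exists\, k_\beta,n_\beta\ \text{such that}\ \frac{n\log 2}{\log (s_k/s_{k+n})}\le\beta\ \ \forall\, k\ge k_\beta,\ n\ge n_\beta\Bigr\}$$ and $$\dim_L C_a=\sup\Bigl\{\beta:\ \exists\, k_\beta,n_\beta\ \text{such that}\ \frac{n\log 2}{\log (s_k/s_{k+n})}\ge\beta\ \ \forall\, k\ge k_\beta,\ n\ge n_\beta\Bigr\}.$$ Here $k_\beta$ and $n_\beta$ are positive integers, and $k,n$ range over integers.
   Context: Decreasing means $a_j\ge a_{j+1}$ for all $j$. Let $L=\sum_j a_j$. The associated Cantor set $C_a$ is constructed as follows. From $I=[0,L]$ remove an open interval of length $a_1$, leaving two closed intervals $I^1_1$ and $I^1_2$ (left to right). Having constructed the closed intervals $I^k_1,\dots,I^k_{2^k}$ of step $k$ (left to right), remove from each $I^k_j$ an open interval of length $a_{2^k+j-1}$, leaving the closed intervals $I^{k+1}_{2j-1}$ and $I^{k+1}_{2j}$. The positions are uniquely determined by requiring that the length of each $I^k_j$ equal the sum of the lengths of all the open intervals subsequently removed from it. Then $C_a=\bigcap_{k\ge1}\bigcup_{j=1}^{2^k}I^k_j$. For non-empty $F\subset\mathbb{R}$, $N_r(F)$ denotes the minimum number of closed balls of radius $r$ needed to cover $F$, and $B(x,R)$ is the closed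 ball of radius $R$ centred at $x$. The Assouad dimension and the Lower Assouad dimension are $$\dim_A F=\inf\Bigl\{\alpha:\ \exists\, c,\rho>0 \text{ such that } \sup_{x\in F}N_r(B(x,R)\cap F)\le c\left(\tfrac{R}{r}\right)^{\alpha}\text{ for all }0<r<R<\rho\Bigr\},$$ $$\dim_L F=\sup\Bigl\{\alpha:\ \exists\, c,\rho>0 \text{ such that } \inf_{x\in F}N_r(B(x,R)\cap F)\ge c\left(\tfrac{R}{r}\right)^{\alpha}\text{ for all }0<r<R<\rho\Bigr\}.$$ *)

(* Defs.v *)
From HB Require Import structures.
From mathcomp Require Import all_boot all_order all_algebra.
From mathcomp Require Import all_classical all_reals all_analysis.

Set Implicit Arguments.
Unset Strict Implicit.
Unset Printing Implicit Defensive.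

Import Order.TTheory GRing.Theory Num.Theory.
Import numFieldNormedType.Exports.

Local Open Scope classical_set_scope.
Local Open Scope ring_scope.

(** Sequences [a_1, a_2, ...] are functions [a : nat -> R] whose value at [0]
    is never used.  Intervals of a given step are numbered from [0]: the pair
    [(k, j)] with [j < 2 ^ k] stands for the interval usually written
    [I^k_(j+1)], from which a gap of length [a (2 ^ k + j)] is removed, leaving
    [(k.+1, j.*2)] on the left and [(k.+1, j.*2.+1)] on the right. *)

(** At step [k + l] the descendants of [(k, j)] are the [(k + l, j * 2 ^ l + i)]
    with [i < 2 ^ l]; the inner sum is the total length of the gaps removed
    from them. *)
Definition cantor_len (R : realType) (a : nat -> R) (k j : nat) : R :=
  limn (series (fun l : nat =>
    \sum_(i < 2 ^ l) a (2 ^ (k + l) + j * 2 ^ l + i)%N)).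

(** Left endpoint of the interval [(k, j)]: a left child keeps the left endpoint
    of its parent, a right child starts after its left sibling and the gap. *)
Fixpoint cantor_left (R : realType) (a : nat -> R) (k j : nat) : R :=
  if k is k'.+1 then
    cantor_left a k' j./2 +
      (if odd j then cantor_len a k j.-1 + a (2 ^ k' + j./2)%N else 0)
  else 0.

Definition cantor_itv (R : realType) (a : nat -> R) (k j : nat) : set R :=
  `[cantor_left a k j, cantor_left a k j + cantor_len a k j].

Definition cantor_set (R : realType) (a : nat -> R) : set R :=
  \bigcap_(k in [set k | (1 <= k)%N])
    \bigcup_(j in [set j | (j < 2 ^ k)%N]) cantor_itv a k j.

(** Minimum number of closed balls of radius [r] covering [F]; the value is [+oo]
    when no finite cover exists.  The centres need not lie in [F]. *)
Definition covering_number (R : realType) (r : R) (F : set R) : \bar R :=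
  ereal_inf [set ((size c)%:R)%:E | c in
    [set c : seq R | F `<=` \bigcup_(x in [set` c]) closed_ball x r]].

(** The dimensions are infima and suprema in [\bar R], so that no junk value
    arises for empty or unbounded sets of exponents. *)
Definition assouad_dim (R : realType) (F : set R) : \bar R :=
  ereal_inf [set alpha%:E | alpha in [set alpha : R |
    exists c rho : R, [/\ 0 < c, 0 < rho &
      forall r R' : R, 0 < r -> r < R' -> R' < rho ->
        (ereal_sup [set covering_number r (closed_ball x R' `&` F) | x in F]
          <= (c * (R' / r) `^ alpha)%:E)%E]]].

Definition lower_assouad_dim (R : realType) (F : set R) : \bar R :=
  ereal_sup [set alpha%:E | alpha in [set alpha : R |
    exists c rho : R, [/\ 0 < c, 0 < rho &
      forall r R' : R, 0 < r -> r < R' -> R' < rho ->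
        ((c * (R' / r) `^ alpha)%:E
          <= ereal_inf [set covering_number r (closed_ball x R' `&` F) | x in F])%E]]].

(** The quantity [s_n], which is the average length of the [2 ^ n] intervals of
    step [n]. *)
Definition avg_len (R : realType) (a : nat -> R) (n : nat) : R :=
  2 ^- n * limn (fun m : nat => \sum_(2 ^ n <= j < m) a j : R).

(* Main.v *)
Require Import Defs.
From HB Require Import structures.
From mathcomp Require Import all_boot all_order all_algebra.
From mathcomp Require Import all_classical all_reals all_analysis.
From mathcomp Require Import zify ring lra.

Set Implicit Arguments.
Unset Strict Implicit.
Unset Printing Implicit Defensive.

Import Order.TTheory GRing.Theory Num.Theory.
Import numFieldNormedType.Exports.

Local Open Scope classical_set_scope.
Local Open Scope ring_scope.

(** Write [s k] for [avg_len a k] and [len k j] for [cantor_len a k j].  Lengths of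
    intervals of one step may differ, but monotonicity of [a] pins all of them
    between neighbouring averages: [s k.+1 <= len k j <= s (k - 1)].  This follows
    by comparing, one later step after another, the [2 ^ l] gaps removed from the
    descendants of an interval with the dyadic block of [a] just before or just
    after them ([len_ge], [lenS_le]).  So up to a bounded shift of the step, the
    set behaves like a Cantor set whose step [k] consists of [2 ^ k] intervals of
    the same length [s k].

    Let [B] be a closed ball of radius [rho] about [s k], and take balls of radius
    [r] about [s (k + n)].  At most three intervals of a step near [k] meet [B],
    as those in between fit inside it and are at least [rho] long; each of them
    splits into about [2 ^ n] intervals of length at most [r], hence
    [covering_number_le].  Conversely, [B] centred at a point of the set contains
    a whole interval of a step near [k], and the left endpoints of its
    descendants near step [k + n] belong to the set and are more than [2 * r]
    apart, hence [covering_number_ge].  Both bounds agree with [2 ^ n] up to a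
    constant factor.

    Thus an exponent [alpha] is admissible for the Assouad dimension (for its
    lower version) when [2 ^ n] is bounded above (below) by a constant times
    [(s k / s (k + n)) `^ alpha], uniformly for large [k].  The condition on
    [n ln 2 / ln (s k / s (k + n))] is this same bound with constant [1] and with
    [n] large.  The two agree up to an arbitrarily small change of exponent, as
    [s k / s (k + n) >= 2 ^ n], so that any power of positive exponent of this
    ratio eventually exceeds any constant; passing to the infimum or supremum
    removes the change.  The four inequalities are [assouad_dim_le_of_growth],
    [growth_of_assouad_bound], [lower_assouad_dim_ge_of_growth] and
    [growth_of_lower_assouad_bound]. *)

(** * Auxiliary facts *)

(** [lia] spends very long on hypotheses over a real field; only those over [nat]
    are kept. *)
Local Ltac nat_lia :=
  repeat match goal with
  | H : ?T |- _ =>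
    lazymatch type of T with
    | Prop => lazymatch T with is_true (leq _ _) => fail | _ => clear H end
    end
  end; lia.

Lemma nat_parity (j : nat) : exists i, j = i.*2 \/ j = i.*2.+1.
Proof.
by exists j./2; rewrite -{1 3}(odd_double_half j); case: (odd j); [right|left].
Qed.

Lemma natr_lt_expr2 (R : realType) (n : nat) : n%:R < 2 ^+ n :> R.
Proof. by rewrite -natrX ltr_nat ltn_expl. Qed.

Lemma ler_powR_l (R : realType) (x y e : R) :
  0 <= e -> 0 <= x -> x <= y -> x `^ e <= y `^ e.
Proof. by move=> e0 x0 xy; apply: ge0_ler_powR; rewrite ?nnegrE// (le_trans x0). Qed.

Lemma scale_ratio_le (R : realType) (x x' y y' : R) :
  0 <= x -> 0 < y' -> x <= x' -> y' <= y -> x / y <= x' / y'.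
Proof.
move=> x0 y0 xx yy; apply: ler_pM => //; first by rewrite invr_ge0 ltW// (lt_le_trans y0).
by rewrite lef_pV2// posrE// (lt_le_trans y0).
Qed.

Lemma powR_scale_ge1 (R : realType) (r rho e : R) :
  0 <= e -> 0 < r -> r < rho -> 1 <= (rho / r) `^ e.
Proof.
move=> e0 r0 rrho; rewrite -(powRr0 (rho / r)); apply: ler_powR => //.
by rewrite ler_pdivlMr// mul1r ltW.
Qed.

Lemma closed_ballP (R : realType) (x r y : R) :
  0 < r -> closed_ball x r y <-> x - r <= y <= x + r.
Proof. by move=> r0; rewrite closed_ball_itv//= in_itv. Qed.

Lemma covering_number_ge1 (R : realType) (r : R) (F : set R) :
  F !=set0 -> (1 <= covering_number r F)%E.
Proof.
move=> [x Fx]; apply/ereal_infP => _ [c /= cover <-]; rewrite lee_fin.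
have [y yc _] := cover x Fx.
by case: c yc {cover} => // z c _; rewrite /= ler1n.
Qed.

(** * Tails of the sequence *)

Section CantorSet.
Context (R : realType) (a : nat -> R)
  (a_pos : forall j : nat, (1 <= j)%N -> 0 < a j)
  (a_decr : forall j : nat, (1 <= j)%N -> a j.+1 <= a j)
  (a_summable : cvgn (fun n : nat => \sum_(1 <= j < n) a j : R)).

Local Notation s := (avg_len a).
Local Notation len := (cantor_len a).
Local Notation left := (cantor_left a).
Local Notation tail n := (limn (fun m : nat => \sum_(n <= j < m) a j : R)).

Lemma a_nonincreasing (i j : nat) : (1 <= i)%N -> (i <= j)%N -> a j <= a i.
Proof.
move=> i1 /subnKC <-; elim: (j - i)%N => [|d IH]; first by rewrite addn0.
by rewrite addnS; apply: (le_trans (a_decr _)) IH; rewrite (leq_trans i1)// leq_addr.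
Qed.

Lemma tail_nondecreasing (n : nat) : (1 <= n)%N ->
  nondecreasing_seq (fun m : nat => \sum_(n <= j < m) a j : R).
Proof.
by move=> n1; apply: nondecreasing_series => j nj _; rewrite ltW// a_pos// (leq_trans n1).
Qed.

Lemma sum_drop_le (m n p : nat) : (1 <= m)%N -> (m <= n)%N ->
  \sum_(n <= j < p) a j <= \sum_(m <= j < p) a j.
Proof.
move=> m1 mn; have sum_ge0 q : 0 <= \sum_(m <= j < q) a j.
  by rewrite big_nat sumr_ge0// => j /andP[mj _]; rewrite ltW// a_pos// (leq_trans m1).
have [pn|np] := leqP p n; first by rewrite big_geq.
by rewrite (@big_cat_nat _ _ _ n m)//= ?lerDr// ltnW.
Qed.

Lemma tail_cvg (n : nat) : (1 <= n)%N -> cvgn (fun m : nat => \sum_(n <= j < m) a j : R).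
Proof.
move=> n1; apply: nondecreasing_is_cvgn; first exact: tail_nondecreasing.
exists (tail 1%N) => _ [m _ <-]; apply: (le_trans (sum_drop_le _ _ n1)) => //.
exact: (nondecreasing_cvgn_le (@tail_nondecreasing 1 isT) a_summable).
Qed.

Lemma sum_le_tail (n m : nat) : (1 <= n)%N -> \sum_(n <= j < m) a j <= tail n.
Proof.
move=> n1.
exact: (nondecreasing_cvgn_le (tail_nondecreasing n1) (tail_cvg n1)).
Qed.

Lemma tail_le (n : nat) (M : R) : (1 <= n)%N ->
  (forall m, \sum_(n <= j < m) a j <= M) -> tail n <= M.
Proof. by move=> n1 H; apply: limr_le; [exact: tail_cvg|exact: nearW]. Qed.

Lemma tail_lt (m n : nat) : (1 <= m)%N -> (m < n)%N -> tail n < tail m.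
Proof.
move=> m1 mn; have n1 : (1 <= n)%N by rewrite (leq_trans m1)// ltnW.
suff : tail n <= tail m - a m by move=> /le_lt_trans; apply; rewrite ltrBlDr ltrDl a_pos.
apply: tail_le => // p; rewrite lerBrDl.
have [pm|mp] := leqP p m.
  rewrite big_geq ?(leq_trans pm) ?(ltnW mn)// addr0.
  by rewrite (le_trans _ (sum_le_tail m.+1 m1))// big_nat1.
apply: (le_trans _ (sum_le_tail p m1)).
by rewrite (big_ltn mp) lerD2l sum_drop_le.
Qed.

Lemma tail_gt0 (n : nat) : (1 <= n)%N -> 0 < tail n.
Proof.
move=> n1; apply: (lt_le_trans (a_pos n1)).
by rewrite (le_trans _ (sum_le_tail n.+1 n1))// big_nat1.
Qed.

Lemma avg_len_gt0 (k : nat) : 0 < s k.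
Proof. by rewrite mulr_gt0 ?tail_gt0 ?expn_gt0// invr_gt0 exprn_gt0. Qed.

(** The average length at least halves from one step to the next, since the gaps
    of step [k] are lost. No bound on [s k / s k.+1] from above exists in general,
    so every comparison of scales below goes through the index of [s]. *)
Lemma avg_len_half (k : nat) : s k.+1 *+ 2 < s k.
Proof.
rewrite /avg_len -[_ *+ 2]mulr_natl exprS invfM !mulrA divff// mul1r.
by rewrite ltr_pM2l ?invr_gt0 ?exprn_gt0// tail_lt ?expn_gt0// ltn_exp2l.
Qed.

(** * Interval lengths *)

Lemma dyadic_blocks (k n : nat) :
  \sum_(2 ^ k <= j < 2 ^ (k + n)) a j =
  \sum_(0 <= l < n) \sum_(2 ^ (k + l) <= j < 2 ^ (k + l).+1) a j.
Proof.
elim: n => [|n IH]; first by rewrite addn0 !big_geq.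
by rewrite big_nat_recr//= -IH addnS -big_cat_nat// leq_exp2l// leq_addr.
Qed.

Lemma dyadic_block_le (k : nat) :
  \sum_(2 ^ k <= j < 2 ^ k.+1) a j <= 2 ^+ k * a (2 ^ k)%N.
Proof.
apply: (@le_trans _ _ (\sum_(2 ^ k <= j < 2 ^ k.+1) a (2 ^ k)%N)).
  by apply: ler_sum_nat => j /andP[kj _]; rewrite a_nonincreasing// expn_gt0.
by rewrite sumr_const_nat -[a _ *+ _]mulr_natl expnS mul2n -addnn addnK natrX.
Qed.

Lemma dyadic_block_ge (k : nat) :
  2 ^+ k * a (2 ^ k.+1)%N <= \sum_(2 ^ k <= j < 2 ^ k.+1) a j.
Proof.
apply: (@le_trans _ _ (\sum_(2 ^ k <= j < 2 ^ k.+1) a (2 ^ k.+1)%N)); last first.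
  apply: ler_sum_nat => j /andP[kj jk]; rewrite a_nonincreasing// ?(ltnW jk)//.
  by rewrite (leq_trans _ kj)// expn_gt0.
by rewrite sumr_const_nat -[a _ *+ _]mulr_natl expnS mul2n -addnn addnK natrX.
Qed.

(** The total length of the gaps removed from the descendants of [(k, j)] at
   step [k + l], i.e. the general term of the series defining [len k j]. *)
Local Notation gaps k j l := (\sum_(i < 2 ^ l) a (2 ^ (k + l) + j * 2 ^ l + i)%N).

Lemma gaps_ge0 (k j l : nat) : 0 <= gaps k j l.
Proof.
apply: sumr_ge0 => i _; rewrite ltW// a_pos// -addnA.
by rewrite (leq_trans _ (leq_addr _ _))// expn_gt0.
Qed.

(** The [2 ^ l] terms on the left have indices at least [2 ^ (k + l).+1], so none
    exceeds the average of the previous dyadic block of [a]. Summed over [l], this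
    gives [len k.+1 j <= s k] and the convergence of the series. *)
Lemma gaps_le (k j l : nat) :
  gaps k.+1 j l <= 2 ^- k * \sum_(2 ^ (k + l) <= j < 2 ^ (k + l).+1) a j.
Proof.
apply: (@le_trans _ _ (2 ^- k * (2 ^+ (k + l) * a (2 ^ (k + l).+1)%N))); last first.
  by rewrite ler_pM2l ?dyadic_block_ge// invr_gt0 exprn_gt0.
rewrite exprD !mulrA mulVf ?mul1r ?expf_neq0//.
apply: (@le_trans _ _ (\sum_(i < 2 ^ l) a (2 ^ (k + l).+1)%N)).
  apply: ler_sum => i _; apply: a_nonincreasing; first by rewrite expn_gt0.
  by rewrite addSn -addnA leq_addr.
by rewrite sumr_const card_ord -[a _ *+ _]mulr_natl natrX.
Qed.

(** For [j < 2 ^ k] the terms on the right have indices below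
    [2 ^ (k.+1 + l)], so all of them dominate the whole next dyadic block. *)
Lemma gaps_ge (k j l : nat) : (j < 2 ^ k)%N ->
  2 ^- k.+1 * \sum_(2 ^ (k.+1 + l) <= i < 2 ^ (k.+1 + l).+1) a i <= gaps k j l.
Proof.
move=> jk.
apply: (@le_trans _ _ (2 ^- k.+1 * (2 ^+ (k.+1 + l) * a (2 ^ (k.+1 + l))%N))).
  by rewrite ler_pM2l ?dyadic_block_le// invr_gt0 exprn_gt0.
rewrite exprD !mulrA mulVf ?mul1r ?expf_neq0//.
apply: (@le_trans _ _ (\sum_(i < 2 ^ l) a (2 ^ (k.+1 + l))%N)).
  by rewrite sumr_const card_ord -[a _ *+ _]mulr_natl natrX.
apply: ler_sum => i _; apply: a_nonincreasing.
  by rewrite -addnA (leq_trans _ (leq_addr _ _))// expn_gt0.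
have il := ltn_ord i; rewrite addSn expnS mul2n -addnn -addnA leq_add2l.
apply: (@leq_trans (j.+1 * 2 ^ l)%N); first by rewrite mulSn addnC leq_add2r ltnW.
by rewrite expnD leq_mul2r jk orbT.
Qed.

Lemma series_gaps_nondecreasing (k j : nat) :
  nondecreasing_seq (series (fun l => gaps k j l)).
Proof.
rewrite seriesEnat.
by apply: nondecreasing_series => l _ _; exact: gaps_ge0.
Qed.

Lemma series_gaps_le (k j n : nat) : series (fun l => gaps k.+1 j l) n <= s k.
Proof.
rewrite seriesEnat /=.
apply: (@le_trans _ _ (2 ^- k * \sum_(2 ^ k <= j < 2 ^ (k + n)) a j)).
  by rewrite dyadic_blocks big_distrr /=; apply: ler_sum => l _; exact: gaps_le.
by rewrite ler_pM2l ?sum_le_tail ?expn_gt0// invr_gt0 exprn_gt0.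
Qed.

Lemma gapsS (k j l : nat) : gaps k j l.+1 = gaps k.+1 j.*2 l + gaps k.+1 j.*2.+1 l.
Proof.
rewrite -[gaps k j l.+1](big_mkord xpredT (fun i => a (2 ^ (k + l.+1) + j * 2 ^ l.+1 + i)%N)).
rewrite expnS mul2n -addnn big_mkord big_split_ord /=; congr (_ + _).
  by apply: eq_bigr => i _; congr a; rewrite addnS addSn -mul2n; lia.
by apply: eq_bigr => i _; congr a; rewrite addnS addSn; lia.
Qed.

Lemma series_gapsS (k j n : nat) : series (fun l => gaps k j l) n.+1 =
  a (2 ^ k + j)%N +
  (series (fun l => gaps k.+1 j.*2 l) n + series (fun l => gaps k.+1 j.*2.+1 l) n).
Proof.
rewrite !seriesEnat /= big_nat_recl//; congr (_ + _).
  by rewrite big_ord1 !addn0 muln1.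
by rewrite -big_split /=; apply: eq_bigr => l _; exact: gapsS.
Qed.

Lemma series_gapsS_cvg (k j : nat) : cvgn (series (fun l => gaps k.+1 j l)).
Proof.
apply: nondecreasing_is_cvgn; first exact: series_gaps_nondecreasing.
by exists (s k) => _ [n _ <-]; exact: series_gaps_le.
Qed.

(** Splitting off the first term expresses the series at step [k] by two series
    at step [k.+1]; as
    [series_gaps_le] bounds only the latter, convergence at step [0] comes from
    here as well. *)
Lemma series_gaps_cvg_split (k j : nat) :
  series (fun l => gaps k j l) @ \oo -->
    a (2 ^ k + j)%N + (len k.+1 j.*2 + len k.+1 j.*2.+1).
Proof.
rewrite -cvg_shiftS; under eq_fun do rewrite series_gapsS.
apply: cvgD; first exact: cvg_cst.
by apply: cvgD; exact: series_gapsS_cvg.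
Qed.

Lemma len_split (k j : nat) :
  len k j = len k.+1 j.*2 + a (2 ^ k + j)%N + len k.+1 j.*2.+1.
Proof. by rewrite addrAC addrC; apply/cvg_lim => //; exact: series_gaps_cvg_split. Qed.

Lemma lenS_le (k j : nat) : len k.+1 j <= s k.
Proof.
apply: limr_le; first exact: series_gapsS_cvg.
by apply: nearW => n; exact: series_gaps_le.
Qed.

Lemma len_ge (k j : nat) : (j < 2 ^ k)%N -> s k.+1 <= len k j.
Proof.
move=> jk; rewrite /avg_len mulrC ler_pdivrMr ?exprn_gt0//.
apply: tail_le; first by rewrite expn_gt0.
move=> m; rewrite -ler_pdivrMr ?exprn_gt0// mulrC.
apply: (@le_trans _ _ (series (fun l => gaps k j l) m)); last first.
  apply: nondecreasing_cvgn_le; first exact: series_gaps_nondecreasing.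
  by apply: cvgP; exact: series_gaps_cvg_split.
apply: (@le_trans _ _ (2 ^- k.+1 * \sum_(2 ^ k.+1 <= j < 2 ^ (k.+1 + m)) a j)).
  rewrite ler_pM2l ?invr_gt0 ?exprn_gt0//.
  apply: tail_nondecreasing; first by rewrite expn_gt0.
  apply: (@leq_trans (2 ^ m)); first by rewrite ltnW// ltn_expl.
  by rewrite leq_exp2l// leq_addl.
by rewrite dyadic_blocks big_distrr seriesEnat /=; apply: ler_sum => l _; exact: gaps_ge.
Qed.

(** * Positions of the intervals *)

Lemma len_gt0 (k j : nat) : (j < 2 ^ k)%N -> 0 < len k j.
Proof. by move=> jk; apply: lt_le_trans (len_ge jk); exact: avg_len_gt0. Qed.

Lemma gap_gt0 (k j : nat) : 0 < a (2 ^ k + j)%N.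
Proof. by apply: a_pos; rewrite (leq_trans _ (leq_addr _ _))// expn_gt0. Qed.

Lemma left_even (k j : nat) : left k.+1 j.*2 = left k j.
Proof. by rewrite /= odd_double doubleK addr0. Qed.

Lemma left_odd (k j : nat) :
  left k.+1 j.*2.+1 = left k j + (len k.+1 j.*2 + a (2 ^ k + j)%N).
Proof. by rewrite /= odd_double uphalf_double. Qed.

(** Siblings are separated by the gap between them; two neighbours that are not
    siblings inherit the separation of their parents, because [len_split] makes
    the right endpoints of a parent and of its right child coincide. *)
Lemma right_lt_leftS (k j : nat) : (j.+1 < 2 ^ k)%N ->
  left k j + len k j < left k j.+1.
Proof.
elim: k j => [|k IH] j; first by rewrite expn0.
have [i [->|->]] := nat_parity j; rewrite expnS mul2n => jk.
  by rewrite left_even left_odd ltrD2l ltrDl gap_gt0.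
rewrite -doubleS ltn_double in jk.
by rewrite -doubleS left_even left_odd -addrA -len_split IH.
Qed.

Lemma right_lt_left (k i j : nat) : (i < j)%N -> (j < 2 ^ k)%N ->
  left k i + len k i < left k j.
Proof.
elim: j => // j IH; rewrite ltnS leq_eqVlt => /orP[/eqP ->|ij] jk.
  exact: right_lt_leftS.
apply: (lt_trans (IH ij (ltnW jk))); apply: le_lt_trans (right_lt_leftS jk).
by rewrite lerDl ltW// len_gt0// ltnW.
Qed.

Lemma itv_sub_parent (k j : nat) : (j < 2 ^ k.+1)%N ->
  cantor_itv a k.+1 j `<=` cantor_itv a k j./2.
Proof.
rewrite expnS mul2n => jk x; rewrite /cantor_itv.
have [i ij] := nat_parity j.
have ik : (i < 2 ^ k)%N by case: ij jk => ->; nat_lia.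
have iL : 0 < len k.+1 i.*2 by apply: len_gt0; rewrite expnS mul2n ltn_double.
have iR : 0 < len k.+1 i.*2.+1 by apply: len_gt0; rewrite expnS; nat_lia.
have g0 := gap_gt0 k i; have ls := len_split k i.
case: ij => ->; rewrite ?doubleK ?[_.*2.+1./2]uphalf_double.
  by rewrite left_even ls /= !in_itv /= => /andP[? ?]; apply/andP; split; lra.
by rewrite left_odd ls /= !in_itv /= => /andP[? ?]; apply/andP; split; lra.
Qed.

Lemma itv_sub_ancestor (k l j : nat) : (j < 2 ^ (k + l))%N ->
  cantor_itv a (k + l) j `<=` cantor_itv a k (j %/ 2 ^ l).
Proof.
elim: l j => [|l IH] j; first by rewrite addn0 expn0 divn1 => _ x.
rewrite addnS => jk; apply: subset_trans (itv_sub_parent jk) _.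
rewrite expnS divnMA divn2; apply: IH.
by move: jk; rewrite expnS mul2n; nat_lia.
Qed.

Lemma left_descendant (k l j : nat) : left (k + l) (j * 2 ^ l) = left k j.
Proof.
elim: l => [|l IH]; first by rewrite addn0 muln1.
by rewrite addnS expnS mulnCA mul2n left_even.
Qed.

Lemma left_in_itv (k j : nat) : (j < 2 ^ k)%N -> cantor_itv a k j (left k j).
Proof.
by move=> jk; rewrite /cantor_itv /= in_itv /= lexx lerDl ltW// len_gt0.
Qed.

(** A left endpoint survives: it stays a left endpoint at all later steps. These
    are the points of the set used for lower bounds on covering numbers. *)
Lemma left_in_cantor_set (k j : nat) : (j < 2 ^ k)%N -> cantor_set a (left k j).
Proof.
move=> jk m _.
have [mk|km] := leqP m k.
  have jmk : (j < 2 ^ (m + (k - m)))%N by rewrite subnKC.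
  exists (j %/ 2 ^ (k - m))%N; first by rewrite /= ltn_divLR ?expn_gt0// -expnD.
  apply: (itv_sub_ancestor jmk); rewrite subnKC//; exact: left_in_itv.
have jm : (j * 2 ^ (m - k) < 2 ^ m)%N.
  by rewrite -{2}(subnKC (ltnW km)) expnD ltn_pmul2r ?expn_gt0.
exists (j * 2 ^ (m - k))%N => //.
rewrite -(left_descendant k (m - k)) subnKC ?(ltnW km)//; exact: left_in_itv.
Qed.

Lemma cantor_set_in_itv (k : nat) (x : R) : cantor_set a x ->
  exists2 j, (j < 2 ^ k)%N & cantor_itv a k j x.
Proof.
move=> /(_ k.+1 isT)[j /= jk xj].
have jk1 : (j < 2 ^ (k + 1))%N by rewrite addn1.
exists (j %/ 2 ^ 1)%N; first by rewrite ltn_divLR// -expnD.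
by apply: (itv_sub_ancestor jk1); rewrite addn1.
Qed.

(** * Covering numbers *)

Lemma mem_cantor_itv (k j : nat) (y : R) :
  cantor_itv a k j y <-> left k j <= y <= left k j + len k j.
Proof. by rewrite /cantor_itv /= in_itv. Qed.

(** Otherwise the two intervals right after [i], each at least [rho] long, would
    lie with gaps around them in a window of length [rho + rho]. *)
Lemma far_itvs_not_in_window (k i j : nat) (x rho y z : R) :
  rho <= s k.+1 -> (j < 2 ^ k)%N -> (i + 3 <= j)%N ->
  cantor_itv a k i y -> cantor_itv a k j z -> x - rho <= y -> z <= x + rho -> False.
Proof.
move=> rhos jk ij /mem_cantor_itv/andP[_ yi] /mem_cantor_itv/andP[zj _] yx zx.
have i1 := @right_lt_left k i i.+1 (ltnSn _); have i2 := @right_lt_left k i.+1 i.+2 (ltnSn _).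
have ij3 := @right_lt_left k i.+2 j.
have l1 := @len_ge k i.+1; have l2 := @len_ge k i.+2.
have {}i1 : left k i + len k i < left k i.+1 by apply: i1; nat_lia.
have {}i2 : left k i.+1 + len k i.+1 < left k i.+2 by apply: i2; nat_lia.
have {}ij3 : left k i.+2 + len k i.+2 < left k j by apply: ij3; nat_lia.
have {}l1 : s k.+1 <= len k i.+1 by apply: l1; nat_lia.
have {}l2 : s k.+1 <= len k i.+2 by apply: l2; nat_lia.
lra.
Qed.

(** Only three consecutive intervals of step [k] can meet the ball. Their
    [3 * 2 ^ l.+1] descendants at step [k + l.+1] have length at most
    [s (k + l) <= r], so balls of radius [r] around the left endpoints suffice. *)
Lemma covering_number_le (k l : nat) (x r rho : R) :
  0 < rho -> rho <= s k.+1 -> s (k + l) <= r ->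
  (covering_number r (closed_ball x rho `&` cantor_set a) <= (3 * 2 ^ l.+1)%:R%:E)%E.
Proof.
move=> rho0 rhos sr; have r0 : 0 < r := lt_le_trans (avg_len_gt0 _) sr.
pose meets (j : nat) := `[< (j < 2 ^ k)%N /\
  exists2 y : R, x - rho <= y <= x + rho & cantor_itv a k j y >].
have anc i y : (i < 2 ^ (k + l.+1))%N -> cantor_itv a (k + l.+1) i y ->
    x - rho <= y <= x + rho -> meets (i %/ 2 ^ l.+1)%N.
  move=> ik yi yx; apply/asboolP; split.
    by rewrite ltn_divLR ?expn_gt0// -expnD.
  by exists y => //; exact: (itv_sub_ancestor ik).
have [ex|none] := pselect (exists j, meets j); last first.
  apply: (@le_trans _ _ 0%E); last by rewrite lee_fin.
  apply: ereal_inf_lbound; exists [::] => //= y [/(closed_ballP _ _ rho0) yx Cy].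
  case: (cantor_set_in_itv (k + l.+1) Cy) => i ik yi.
  by exfalso; apply: none; eexists; exact: (anc i y).
case: (ex_minnP ex) => j0 /asboolP[j0k [y0 /andP[y0x _] y0j]] j0_min.
apply: ereal_inf_lbound.
exists [seq left (k + l.+1) i | i <- iota (j0 * 2 ^ l.+1) (3 * 2 ^ l.+1)]; last first.
  by rewrite size_map size_iota.
move=> y [/(closed_ballP _ _ rho0) yx Cy].
have [i ik yi] := cantor_set_in_itv (k + l.+1) Cy.
exists (left (k + l.+1) i); last first.
  apply/closed_ballP => //; move/mem_cantor_itv: yi.
  have := lenS_le (k + l) i; rewrite -addnS => li /andP[yi1 yi2].
  apply/andP; split; lra.
apply: map_f; rewrite mem_iota -mulnDl.
rewrite -leq_divRL ?expn_gt0// -ltn_divLR ?expn_gt0// j0_min ?(anc i y)//=.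
rewrite ltnNge; apply/negP => far.
have ik' : (i %/ 2 ^ l.+1 < 2 ^ k)%N by rewrite ltn_divLR ?expn_gt0// -expnD.
apply: (far_itvs_not_in_window rhos ik' far y0j (itv_sub_ancestor ik yi) y0x).
by case/andP: yx.
Qed.

(** The step [k.+1] interval around [x] is no longer than [s k], so it lies in the
    ball. Its descendants at step [k.+1 + l] are at least [s (k + l).+2] long,
    hence their left endpoints are more than [r *+ 2] apart and no ball of radius
    [r] contains two of them. *)
Lemma covering_number_ge (k l : nat) (x r rho : R) :
  cantor_set a x -> s k <= rho -> 0 < r -> r *+ 2 <= s (k + l).+2 ->
  ((2 ^ l)%:R%:E <= covering_number r (closed_ball x rho `&` cantor_set a))%E.
Proof.
move=> Cx srho r0 rs; have rho0 : 0 < rho := lt_le_trans (avg_len_gt0 _) srho.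
apply/ereal_infP => _ [c /= cover <-]; rewrite lee_fin ler_nat.
have [j jk xj] := cantor_set_in_itv k.+1 Cx.
pose p (i : 'I_(2 ^ l)) := left (k.+1 + l) (j * 2 ^ l + i).
have ik (i : 'I_(2 ^ l)) : (j * 2 ^ l + i < 2 ^ (k.+1 + l))%N.
  rewrite expnD; apply: (@leq_trans (j.+1 * 2 ^ l)); last by rewrite leq_mul2r jk orbT.
  by rewrite mulSn addnC ltn_add2r.
have p_near i : exists y, y \in c /\ closed_ball y r (p i).
  have [|y yc yp] := cover (p i); last by exists y.
  split; last by apply: left_in_cantor_set; exact: ik.
  have := itv_sub_ancestor (ik i) (left_in_itv (ik i)).
  rewrite divnMDl ?expn_gt0// divn_small// addn0 => /mem_cantor_itv/andP[p1 p2].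
  move/mem_cantor_itv: xj => /andP[x1 x2]; have lj := lenS_le k j.
  by apply/closed_ballP => //; apply/andP; split; rewrite /p; lra.
have [f fP] := choice p_near.
have f_lt (i i' : 'I_(2 ^ l)) : (i < i')%N -> f i <> f i'.
  move=> ii' fii'.
  have [[_ /(closed_ballP _ _ r0) b] [_ /(closed_ballP _ _ r0) b']] := (fP i, fP i').
  move: b b'; rewrite fii' /p => /andP[b1 b2] /andP[b3 b4].
  have far : left (k.+1 + l) (j * 2 ^ l + i) + len (k.+1 + l) (j * 2 ^ l + i) <
             left (k.+1 + l) (j * 2 ^ l + i') by apply: right_lt_left; rewrite ?ltn_add2l.
  have := len_ge (ik i); rewrite addSn => leni.
  by move: far b1 b2 b3 b4; rewrite addSn; lra.
have f_inj : injective f.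
  move=> i i' fii'; apply: val_inj => /=.
  by have [/f_lt|/f_lt/(_ (esym fii'))|] := ltngtP i i'.
rewrite -[leqLHS]card_ord cardE -(size_map f); apply: uniq_leq_size.
  by rewrite map_inj_uniq ?enum_uniq.
by move=> _ /mapP[i _ ->]; case: (fP i).
Qed.

(** * Scales *)

Lemma avg_len_nonincreasing (k m : nat) : (k <= m)%N -> s m <= s k.
Proof.
move=> /subnKC <-; elim: (m - k)%N => [|d IH]; first by rewrite addn0.
rewrite addnS; apply: le_trans IH.
by have := avg_len_half (k + d); have := avg_len_gt0 (k + d).+1; lra.
Qed.

Lemma expr2_le_avg_len_ratio (k n : nat) : 2 ^+ n <= s k / s (k + n).
Proof.
rewrite ler_pdivlMr ?avg_len_gt0//.
elim: n => [|n IH]; first by rewrite addn0 mul1r.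
apply: le_trans IH; rewrite exprSr -mulrA ler_pM2l ?exprn_gt0// addnS mulr_natl.
exact/ltW/avg_len_half.
Qed.

Lemma avg_len_small (e : R) : 0 < e -> exists k, s k < e.
Proof.
move=> e0; have se : 0 <= s 0%N / e by rewrite divr_ge0// ltW// avg_len_gt0.
exists (Num.bound (s 0%N / e)); move: (Num.bound _) (archi_boundP se) => n.
rewrite ltr_pdivrMr// => sn.
have := expr2_le_avg_len_ratio 0 n; rewrite ler_pdivlMr ?avg_len_gt0// add0n => ns.
rewrite -(ltr_pM2l (exprn_gt0 n (ltr0n R 2))); apply: (le_lt_trans ns).
by apply: (lt_trans sn); rewrite ltr_pM2r// natr_lt_expr2.
Qed.

Lemma scale_of (k : nat) (r : R) : 0 < r -> r < s k ->
  exists2 m, (k <= m)%N & s m.+1 <= r < s m.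
Proof.
move=> r0 rk; have ex : exists m, s m <= r.
  by have [m /ltW] := avg_len_small r0; exists m.
case: (ex_minnP ex) => -[|m] mr m_min.
  by have := lt_le_trans rk (avg_len_nonincreasing (leq0n k)); rewrite ltNge mr.
exists m; last by rewrite mr ltNge; apply/negP => /m_min; rewrite ltnn.
rewrite leqNgt; apply/negP => /avg_len_nonincreasing /(lt_le_trans rk).
by rewrite ltNge mr.
Qed.

(** * Exponents *)

Lemma avg_len_ratio_ge1 (k n : nat) : 1 <= s k / s (k + n).
Proof. by apply: le_trans (expr2_le_avg_len_ratio k n); rewrite exprn_ege1// ler1n. Qed.

Lemma avg_len_ratio_gt0 (k n : nat) : 0 < s k / s (k + n).
Proof. by rewrite divr_gt0// avg_len_gt0. Qed.

Lemma ln_avg_len_ratio_gt0 (k n : nat) : (0 < n)%N -> 0 < ln (s k / s (k + n)).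
Proof.
move=> n0; rewrite ln_gt0//; apply: lt_le_trans (expr2_le_avg_len_ratio k n).
by rewrite exprn_egt1// ?ltr1n// -lt0n.
Qed.

Lemma growth_exponent_leE (k n : nat) (beta : R) : (0 < n)%N ->
  (n%:R * ln 2 / ln (s k / s (k + n)) <= beta) = (2 ^+ n <= (s k / s (k + n)) `^ beta).
Proof.
move=> n0; rewrite ler_pdivrMr ?ln_avg_len_ratio_gt0//.
rewrite -[in RHS]ler_ln ?posrE ?exprn_gt0 ?powR_gt0 ?avg_len_ratio_gt0//.
by rewrite lnXn// mulr_natl ln_powR.
Qed.

Lemma growth_exponent_geE (k n : nat) (beta : R) : (0 < n)%N ->
  (beta <= n%:R * ln 2 / ln (s k / s (k + n))) = ((s k / s (k + n)) `^ beta <= 2 ^+ n).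
Proof.
move=> n0; rewrite ler_pdivlMr ?ln_avg_len_ratio_gt0//.
rewrite -[in RHS]ler_ln ?posrE ?exprn_gt0 ?powR_gt0 ?avg_len_ratio_gt0//.
by rewrite lnXn// mulr_natl ln_powR.
Qed.

(** What allows multiplicative constants to be traded for a small change [e] of
    the exponent, uniformly in [k]. *)
Lemma avg_len_ratio_powR_large (C e : R) : 0 < e ->
  exists n0, forall k n, (n0 <= n)%N -> C <= (s k / s (k + n)) `^ e.
Proof.
move=> e0; have [C0|C0] := leP C 0.
  by exists 0%N => k n _; apply: (le_trans C0); exact: powR_ge0.
have l2 : 0 < ln 2 :> R by rewrite ln_gt0// ltr1n.
have [n0 n0P] : exists n0 : nat, ln C <= n0%:R * (e * ln 2).
  exists (Num.bound (`|ln C| / (e * ln 2))).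
  rewrite -ler_pdivrMr ?mulr_gt0//; apply: le_trans (ltW (archi_boundP _)).
    by rewrite ler_pM2r ?ler_norm// invr_gt0 mulr_gt0.
  by rewrite divr_ge0// ltW// mulr_gt0.
exists n0 => k n n0n.
apply: (@le_trans _ _ ((2 ^+ n) `^ e)).
  rewrite -ler_ln ?posrE ?powR_gt0 ?exprn_gt0//; apply: (le_trans n0P).
  rewrite ln_powR lnXn// -[ln 2 *+ n]mulr_natl [e * (_ * _)]mulrCA ler_pM2r ?mulr_gt0//.
  by rewrite ler_nat.
apply: ge0_ler_powR; rewrite ?nnegrE ?exprn_ge0 ?(ltW e0) ?expr2_le_avg_len_ratio//.
exact/ltW/avg_len_ratio_gt0.
Qed.

(** * Dimensions *)

(** With [s k.+2 <= rho < s k.+1] and [s m.+1 <= r < s m], counting gives at most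
    [3 * 2 ^ (d + 3) = 48 * 2 ^ (d - 1)] balls, where [d = m - k.+1]. Since
    [rho / r] is at least [s k.+2 / s m], the assumed growth over the [d - 1] steps
    between [k.+2] and [m] bounds this when [d > nb]; the factor [2 ^ nb] takes
    care of the remaining pairs of nearby scales. *)
Lemma assouad_dim_le_of_growth (beta : R) (kb nb : nat) :
  (forall k n, (kb <= k)%N -> (nb <= n)%N -> 2 ^+ n <= (s k / s (k + n)) `^ beta) ->
  (assouad_dim (cantor_set a) <= beta%:E)%E.
Proof.
move=> growth.
have beta_gt0 : 0 < beta.
  rewrite ltNge; apply/negP => beta0.
  have := ler_powR (avg_len_ratio_ge1 kb nb.+1) beta0.
  move=> /(le_trans (growth _ _ (leqnn _) (leqnSn _))); rewrite powRr0 leNgt.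
  by rewrite exprn_egt1// ltr1n.
apply: ereal_inf_lbound; exists beta => //.
exists (48 * 2 ^+ nb), (s kb.+1); split.
- by rewrite mulr_gt0 ?exprn_gt0.
- exact: avg_len_gt0.
move=> r rho r0 r_rho rho_kb; have rho0 := lt_trans r0 r_rho.
apply/ereal_supP => _ [x _ <-].
have [[//|k] kk /andP[k_rho rho_k]] := scale_of rho0 rho_kb.
have [m km /andP[mr rm]] := scale_of r0 (lt_trans r_rho rho_k).
pose d := (m - k.+1)%N.
have P1 := powR_scale_ge1 (ltW beta_gt0) r0 r_rho.
have p2nb : 1 <= 2 ^+ nb :> R by rewrite exprn_ege1// ler1n.
apply: (le_trans (@covering_number_le k d.+2 x r rho rho0 (ltW rho_k) _)).
  by rewrite (_ : k + d.+2 = m.+1)%N// /d; nat_lia.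
rewrite lee_fin natrM natrX.
have [nbd|dnb] := ltnP nb d.
  have := growth k.+2 d.-1; rewrite (_ : k.+2 + d.-1 = m)%N; last first.
    by rewrite /d in nbd *; nat_lia.
  move=> /(_ ltac:(nat_lia) ltac:(nat_lia)) dP.
  have {}dP : 2 ^+ d.-1 <= (rho / r) `^ beta.
    apply: (le_trans dP); apply: ler_powR_l; rewrite ?(ltW beta_gt0)//.
      by rewrite divr_ge0// ltW// avg_len_gt0.
    by apply: scale_ratio_le; rewrite ?k_rho ?(ltW rm)// ltW// avg_len_gt0.
  rewrite -{1}(ltn_predK nbd) !exprS; nra.
have : 2 ^+ d <= 2 ^+ nb :> R by rewrite ler_weXn2l// ler1n.
by rewrite !exprS; nra.
Qed.

(** Test the covering bound around the point [0] at [rho = s k] and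
    [r = s (k + n) / 2], where halving makes a ball of radius [r] too small for two
    left endpoints of step [k + n - 1]. The constant [4 * c * 2 `^ alpha] to be
    absorbed comes from the two lost steps and from this halving. *)
Lemma growth_of_assouad_bound (alpha c rho0 e : R) : 0 < c -> 0 < rho0 -> 0 < e ->
  (forall r rho : R, 0 < r -> r < rho -> rho < rho0 ->
    (ereal_sup [set covering_number r (closed_ball x rho `&` cantor_set a)
               | x in cantor_set a] <= (c * (rho / r) `^ alpha)%:E)%E) ->
  exists kb nb : nat, forall k n, (kb <= k)%N -> (nb <= n)%N ->
    2 ^+ n <= (s k / s (k + n)) `^ (alpha + e).
Proof.
move=> c0 rho00 e0 cover.
have [kb kb_rho] := avg_len_small rho00.
have [nb nbP] := avg_len_ratio_powR_large (4 * c * 2 `^ alpha) e0.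
exists kb, (maxn nb 2) => k n kbk; rewrite geq_max => /andP[nbn n2].
have sk0 := avg_len_gt0 k; have skn0 := avg_len_gt0 (k + n).
have skn := avg_len_nonincreasing (leq_addr n k).
have r0 : 0 < s (k + n) / 2 by rewrite divr_gt0.
have r_rho : s (k + n) / 2 < s k by lra.
have rho_kb : s k < rho0 := le_lt_trans (avg_len_nonincreasing kbk) kb_rho.
have C0 : cantor_set a (left 0 0) by apply: left_in_cantor_set.
have l_le : s (k + n) / 2 *+ 2 <= s (k + (n - 2)).+2.
  by rewrite -mulr_natr divfK// (_ : (k + (n - 2)).+2 = k + n)%N//; nat_lia.
have := covering_number_ge C0 (lexx (s k)) r0 l_le.
have /ereal_supP/(_ _ (ex_intro2 _ _ _ C0 erefl)) := cover _ _ r0 r_rho rho_kb.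
move=> /[swap] /le_trans/[apply]; rewrite lee_fin natrX => N_le.
have -> : 2 ^+ n = 4 * 2 ^+ (n - 2) :> R.
  by rewrite -[in LHS](subnKC n2) exprD; ring.
apply: (@le_trans _ _ (4 * (c * (s k / (s (k + n) / 2)) `^ alpha))); first by rewrite ler_pM2l.
have -> : s k / (s (k + n) / 2) = 2 * (s k / s (k + n)).
  by field; rewrite gt_eqF.
rewrite powRM ?(ltW (avg_len_ratio_gt0 _ _))// powRD; last first.
  by apply/implyP => _; rewrite gt_eqF// avg_len_ratio_gt0.
have /(ler_wpM2l (powR_ge0 (s k / s (k + n)) alpha)) := nbP k n nbn.
by apply: le_trans; rewrite le_eqVlt; apply/orP; left; apply/eqP; ring.
Qed.

(** With [s k.+1 <= rho < s k] and [s m.+1 <= r < s m], at least [2 ^ (m - k - 4)]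
    balls are needed when [m >= k + 4], and at least one in all cases. The assumed
    growth bounds [(rho / r) `^ beta] by [2 ^ n] for [n = m.+1 - k + nb], which is
    long enough for the assumption to apply; the constant [2 ^- (nb + 5)] absorbs
    the difference. A nonpositive exponent makes the required bound at most [1]. *)
Lemma lower_assouad_dim_ge_of_growth (beta : R) (kb nb : nat) :
  (forall k n, (kb <= k)%N -> (nb <= n)%N -> (s k / s (k + n)) `^ beta <= 2 ^+ n) ->
  (beta%:E <= lower_assouad_dim (cantor_set a))%E.
Proof.
move=> growth; apply: ereal_sup_ubound; exists beta => //.
exists (2 ^- (nb + 5)), (s kb); split.
- by rewrite invr_gt0 exprn_gt0.
- exact: avg_len_gt0.
move=> r rho r0 r_rho rho_kb; have rho0 := lt_trans r0 r_rho.
apply/ereal_infP => _ [x Cx <-].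
have N1 : (1 <= covering_number r (closed_ball x rho `&` cantor_set a))%E.
  by apply: covering_number_ge1; exists x; split => //; exact: closed_ballxx.
have p2 : 0 < 2 ^- (nb + 5) :> R by rewrite invr_gt0 exprn_gt0.
have p2K n : 2 ^+ n <= 2 ^+ (nb + 5) :> R -> 2 ^- (nb + 5) * 2 ^+ n <= 1 :> R.
  by move=> ?; rewrite mulrC ler_pdivrMr ?exprn_gt0// mul1r.
have [beta0|beta0] := leP beta 0.
  apply: le_trans N1; rewrite lee_fin; apply: le_trans (p2K 0%N _).
    rewrite ler_pM2l// expr0 -(powRr0 (rho / r)) ler_powR//.
    by rewrite ler_pdivlMr// mul1r ltW.
  by rewrite ler_weXn2l// ler1n.
have [k kk /andP[k_rho rho_k]] := scale_of rho0 rho_kb.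
have [m km /andP[mr rm]] := scale_of r0 (lt_trans r_rho rho_k).
pose n := (m.+1 - k + nb)%N.
have P_le : 2 ^- (nb + 5) * (rho / r) `^ beta <= 2 ^- (nb + 5) * 2 ^+ n.
  rewrite ler_pM2l//; apply: le_trans (growth k n kk (leq_addl _ _)).
  apply: ler_powR_l; rewrite ?(ltW beta0) ?divr_ge0 ?(ltW rho0) ?(ltW r0)//.
  apply: scale_ratio_le; rewrite ?(ltW rho0) ?(ltW rho_k) ?avg_len_gt0//.
  by apply: le_trans mr; apply: avg_len_nonincreasing; rewrite /n; nat_lia.
have [mk|mk] := ltnP m (k + 4)%N.
  apply: le_trans N1; rewrite lee_fin (le_trans P_le)// p2K// ler_weXn2l ?ler1n//.
  by rewrite /n; nat_lia.
have r2 : r *+ 2 <= s (k.+1 + (m - (k + 4))).+2.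
  rewrite (_ : (k.+1 + (m - (k + 4))).+2 = m.-1)%N; last by nat_lia.
  by have := avg_len_half m.-1; rewrite prednK; [lra|nat_lia].
apply: le_trans (covering_number_ge Cx k_rho r0 r2).
rewrite lee_fin (le_trans P_le)// mulrC ler_pdivrMr ?exprn_gt0// natrX -exprD.
by rewrite ler_weXn2l ?ler1n// /n; nat_lia.
Qed.

(** Test the covering bound at [rho = s k] and [r = s (k + n)] around the
    point [0]; the count there is at most [12 * 2 ^ n]. *)
Lemma growth_of_lower_assouad_bound (alpha c rho0 e : R) : 0 < c -> 0 < rho0 -> 0 < e ->
  (forall r rho : R, 0 < r -> r < rho -> rho < rho0 ->
    ((c * (rho / r) `^ alpha)%:E <=
      ereal_inf [set covering_number r (closed_ball x rho `&` cantor_set a)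
                | x in cantor_set a])%E) ->
  exists kb nb : nat, forall k n, (kb <= k)%N -> (nb <= n)%N ->
    (s k / s (k + n)) `^ (alpha - e) <= 2 ^+ n.
Proof.
move=> c0 rho00 e0 cover.
have [kb kb_rho] := avg_len_small rho00.
have [nb nbP] := avg_len_ratio_powR_large (12 / c) e0.
exists kb.+1, nb.+1 => -[//|k] n kbk nbn.
have sk0 := avg_len_gt0 k.+1; have skn0 := avg_len_gt0 (k.+1 + n).
have r_rho : s (k.+1 + n) < s k.+1.
  rewrite -(ltr_pM2r (_ : 0 < (s (k.+1 + n))^-1)) ?invr_gt0// divff ?gt_eqF//.
  apply: lt_le_trans (expr2_le_avg_len_ratio k.+1 n).
  by rewrite exprn_egt1 ?ltr1n//; nat_lia.
have rho_kb : s k.+1 < rho0.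
  by apply: le_lt_trans kb_rho; apply: avg_len_nonincreasing; nat_lia.
have C0 : cantor_set a (left 0 0) by apply: left_in_cantor_set.
have sr : s (k + n.+1) <= s (k.+1 + n) by rewrite addnS addSn.
have := covering_number_le (left 0 0) sk0 (lexx _) sr.
have /ereal_infP/(_ _ (ex_intro2 _ _ _ C0 erefl)) := cover _ _ skn0 r_rho rho_kb.
move=> /le_trans/[apply]; rewrite lee_fin natrM natrX => N_le.
set Q := s k.+1 / s (k.+1 + n) in N_le *.
have Q0 : 0 < Q := avg_len_ratio_gt0 k.+1 n.
have /(_ (ltnW nbn)) := nbP k.+1 n; rewrite -/Q => Qe.
rewrite powRB; last by apply/implyP => _; rewrite gt_eqF.
rewrite ler_pdivrMr ?powR_gt0//.
apply: le_trans (ler_wpM2l (exprn_ge0 n (ler0n R 2)) Qe).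
rewrite mulrA ler_pdivlMr// mulrC; apply: (le_trans N_le).
by rewrite le_eqVlt; apply/orP; left; apply/eqP; rewrite !exprS; ring.
Qed.

End CantorSet.

Theorem theorem2 (R : realType) (a : nat -> R)
    (a_pos : forall j : nat, (1 <= j)%N -> 0 < a j)
    (a_decr : forall j : nat, (1 <= j)%N -> a j.+1 <= a j)
    (a_summable : cvgn (fun n : nat => \sum_(1 <= j < n) a j : R)) :
  assouad_dim (cantor_set a) =
    ereal_inf [set beta%:E | beta in [set beta : R |
      exists kb nb : nat, [/\ (0 < kb)%N, (0 < nb)%N &
        forall k n : nat, (kb <= k)%N -> (nb <= n)%N ->
          n%:R * ln 2 / ln (avg_len a k / avg_len a (k + n)) <= beta]]]
  /\
  lower_assouad_dim (cantor_set a) =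
    ereal_sup [set beta%:E | beta in [set beta : R |
      exists kb nb : nat, [/\ (0 < kb)%N, (0 < nb)%N &
        forall k n : nat, (kb <= k)%N -> (nb <= n)%N ->
          beta <= n%:R * ln 2 / ln (avg_len a k / avg_len a (k + n))]]].
Proof.
split; apply/eqP; rewrite eq_le; apply/andP; split.
- apply/ereal_infP => _ [beta [kb [nb [_ nb0 ratio]]] <-].
  apply: (@assouad_dim_le_of_growth _ _ a_pos a_decr a_summable _ kb nb) => k n kk nn.
  by rewrite -growth_exponent_leE// ?ratio// (leq_trans nb0).
- apply/ereal_infP => _ [alpha [c [rho [c0 rho0 cover]]] <-].
  apply/lee_addgt0Pr => e e0; rewrite -EFinD.
  have [kb [nb growth]] := growth_of_assouad_bound a_pos a_decr a_summable c0 rho0 e0 cover.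
  apply: ereal_inf_lbound; exists (alpha + e) => //; exists kb.+1, nb.+1.
  split=> // k n kk nn; rewrite growth_exponent_leE//; last by rewrite (leq_trans _ nn).
  by apply: growth; rewrite ltnW.
- apply/ereal_supP => _ [alpha [c [rho [c0 rho0 cover]]] <-].
  apply/lee_subgt0Pr => e e0; rewrite -EFinB.
  have [kb [nb growth]] :=
    growth_of_lower_assouad_bound a_pos a_decr a_summable c0 rho0 e0 cover.
  apply: ereal_sup_ubound; exists (alpha - e) => //; exists kb.+1, nb.+1.
  split=> // k n kk nn; rewrite growth_exponent_geE//; last by rewrite (leq_trans _ nn).
  by apply: growth; rewrite ltnW.
- apply/ereal_supP => _ [beta [kb [nb [_ nb0 ratio]]] <-].
  apply: (@lower_assouad_dim_ge_of_growth _ _ a_pos a_decr a_summable _ kb nb) => k n kk nn.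
  by rewrite -growth_exponent_geE// ?ratio// (leq_trans nb0).
Qed.
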